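(* For each $k\in\mathbb{N}$ and any TOP isotopy (i.e. homotopy through one-to-one continuous maps) $h_t\colon mS^1\to\mathbb{R}^3$, $t\in[0,1]$, there exists an $\varepsilon>0$ such that any generic PL homotopy $l_t\colon mS^1\to\mathbb{R}^3\subset S^3$, $t\in[0,1]$, that is $\varepsilon$-close to $h_t$, is a strong $k$-quasi-isotopy.
   Context: $\mathbb{N}$ contains $0$; $mS^1=S^1_1\sqcup\dots\sqcup S^1_m$. A PL homotopy of maps $mS^1\to S^3$ is generic if it passes through embeddings at all but finitely many times, and at each exceptional time the map (a singular link of the homotopy) has exactly one double point, which is transversal in the usual general position sense. A PL map $f\colon mS^1\to S^3$ with precisely one double point $x$ is a strong $k$-quasi-embedding if, in addition to the singleton $P_0=\{x\}$, there exist PL $3$-balls $P_1,\dots,P_k\subset S^3$ and arcs $J_0,\dots,J_k\subset mS^1$ with $\partial J_0=f^{-1}(x)$ such that $f^{-1}(P_j)\subset J_j$ for each $j\le k$, and $P_j\cup f(J_j)\subset P_{j+1}$ for each $j<k$, the latter inclusion being null-homotopic for each $j<k$ (automatic for balls). A strong $k$-quasi-isotopy is a generic PL homotopy all of whose singular links are strong $k$-quasi-embeddings. Here ''$\varepsilon$-close'' means that $l_t(x)$ is $\varepsilon$-close to $h_t(x)$ for all $t$ and $x$. *)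

(* Defs.v *)
From HB Require Import structures.
From mathcomp Require Import all_boot all_order all_algebra.
From mathcomp Require Import all_classical all_reals all_analysis.
Set Implicit Arguments.
Unset Strict Implicit.
Unset Printing Implicit Defensive.
Import Order.TTheory GRing.Theory Num.Theory.
Import numFieldNormedType.Exports.
Local Open Scope classical_set_scope.
Local Open Scope ring_scope.

(* The norm on ['rV[R]_n] is the max norm, hence its unit
   ball is the cube [-1,1]^n and its unit sphere is the boundary of that cube;
   these are the standard PL ball and PL sphere. *)

Section PL.
Context {R : realType}.

Definition convex_polyhedron (V : lmodType R) (A : set V) : Prop :=
  exists (n : nat) (a : 'I_n -> {scalar V}) (b : 'I_n -> R),
    A = [set x | forall i, a i x <= b i].

Definition affine_on (V W : lmodType R) (A : set V) (f : V -> W) : Prop :=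
  forall x y (s : R), A x -> A y -> 0 <= s <= 1 ->
    f (s *: x + (1 - s) *: y) = s *: f x + (1 - s) *: f y.

(* In particular K is a polyhedron; continuity of f on K is automatic, since
   the finitely many pieces are closed. *)
Definition pl_on (V W : lmodType R) (K : set V) (f : V -> W) : Prop :=
  exists (n : nat) (C : 'I_n -> set V),
    [/\ forall i, convex_polyhedron (C i),
        K = \bigcup_(i in [set: 'I_n]) C i &
        forall i, affine_on (C i) f].

(* To be used for compact K only, where an injective continuous map is an
   embedding. *)
Definition pl_embedding (V W : lmodType R) (K : set V) (f : V -> W) : Prop :=
  pl_on K f /\ set_inj K f.

Definition cube (V : normedModType R) : set V := [set x | `|x| <= 1].
Arguments cube V _ : clear implicits.

Definition sphere (n : nat) : set 'rV[R]_n.+1 := [set x | `|x| = 1].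
Arguments sphere n _ : clear implicits.

Definition pl_3ball (P : set 'rV[R]_4) : Prop :=
  exists phi : 'rV[R]_3 -> 'rV[R]_4,
    [/\ pl_embedding (cube 'rV[R]_3) phi,
        phi @` cube 'rV[R]_3 = P & P `<=` sphere 3].

(* A PL identification of R^3 with the complement of a point in S^3.  PL on
   R^3 means PL on arbitrarily large compact cubes, with possibly infinitely
   many pieces in total. *)
Definition pl_R3_in_S3 (iota : 'rV[R]_3 -> 'rV[R]_4) : Prop :=
  [/\ forall r : R, pl_on [set x : 'rV[R]_3 | `|x| <= r] iota,
      exists2 pt, sphere 3 pt & range iota = sphere 3 `\ pt &
      exists2 g : 'rV[R]_4 -> 'rV[R]_3,
        cancel iota g & {within range iota, continuous g}].

(* m S^1, the i-th circle being {i} x (boundary of a square) *)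
Definition circles (m : nat) : set ('I_m * 'rV[R]_2) :=
  [set p | sphere 1 p.2].

Definition unit_time (t : R) : Prop := 0 <= t <= 1.

Definition annulus : set (R^o * 'rV[R]_2) :=
  [set z | unit_time z.1 /\ sphere 1 z.2].

Definition top_isotopy (m n : nat) (h : R -> 'I_m * 'rV[R]_2 -> 'rV[R]_n) :
    Prop :=
  (forall i, {within annulus, continuous
     (fun z : R^o * 'rV[R]_2 => h z.1 (i, z.2))}) /\
  (forall t, unit_time t -> set_inj (@circles m) (h t)).

Definition pl_map (m : nat) (f : 'I_m * 'rV[R]_2 -> 'rV[R]_4) : Prop :=
  (forall i, pl_on (sphere 1) (fun u => f (i, u))) /\
  (forall p, circles p -> sphere 3 (f p)).

Definition pl_homotopy (m : nat) (l : R -> 'I_m * 'rV[R]_2 -> 'rV[R]_4) :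
    Prop :=
  (forall i, pl_on annulus (fun z : R^o * 'rV[R]_2 => l z.1 (i, z.2))) /\
  (forall t p, unit_time t -> circles p -> sphere 3 (l t p)).

Definition fiber (m : nat) (T : Type) (f : 'I_m * 'rV[R]_2 -> T) (P : set T) :
    set ('I_m * 'rV[R]_2) :=
  @circles m `&` f @^-1` P.

(* x is the only point with more than one preimage, and it has exactly the two
   preimages p and q *)
Definition only_double_point (m : nat) (T : Type)
    (f : 'I_m * 'rV[R]_2 -> T) (x : T) (p q : 'I_m * 'rV[R]_2) : Prop :=
  [/\ p <> q, fiber f [set x] = [set p; q] &
      forall p' q', circles p' -> circles q' -> f p' = f q' ->
        p' = q' \/ f p' = x].

Definition track (m : nat) (l : R -> 'I_m * 'rV[R]_2 -> 'rV[R]_4) (i : 'I_m)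
    (z : R^o * 'rV[R]_2) : 'rV[R]_4 * R^o :=
  (l z.1 (i, z.2), z.1).

(* The track of the homotopy embeds some neighbourhood of (t, p) in
   [0,1] x m S^1 onto the part of D lying in S^3 x [0,1]. *)
Definition sheet (m : nat) (l : R -> 'I_m * 'rV[R]_2 -> 'rV[R]_4) (t : R)
    (p : 'I_m * 'rV[R]_2) (D : set ('rV[R]_4 * R^o)) : Prop :=
  exists A : set (R^o * 'rV[R]_2),
    [/\ within annulus (nbhs ((t : R^o), p.2)) A, A `<=` annulus,
        set_inj A (track l p.1) &
        track l p.1 @` A = D `&` [set y | unit_time y.2]].

(* PL transversality of the two sheets, of dimension 2 each, of the track
   [0,1] x m S^1 -> S^3 x [0,1]: there is a chart psi : I^2 x I^2 -> S^3 x R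
   around the double point carrying I^2 x 0 and 0 x I^2 to the two sheets.
   The image of psi is a neighbourhood of psi(0) by invariance of domain.
   Restricting to S^3 x [0,1] matters only for t = 0 and t = 1. *)
Definition transversal_double_point (m : nat)
    (l : R -> 'I_m * 'rV[R]_2 -> 'rV[R]_4) (t : R) (x : 'rV[R]_4)
    (p q : 'I_m * 'rV[R]_2) : Prop :=
  exists psi : 'rV[R]_2 * 'rV[R]_2 -> 'rV[R]_4 * R^o,
    [/\ pl_embedding (cube ('rV[R]_2 * 'rV[R]_2)%type) psi,
        forall z, cube _ z -> sphere 3 (psi z).1,
        psi 0 = (x, t),
        sheet l t p [set psi (u, 0) | u in cube 'rV[R]_2] &
        sheet l t q [set psi (0, v) | v in cube 'rV[R]_2]].

Definition singular_time (m : nat) (l : R -> 'I_m * 'rV[R]_2 -> 'rV[R]_4)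
    (t : R) : Prop :=
  unit_time t /\ ~ set_inj (@circles m) (l t).

Definition generic_pl_homotopy (m : nat)
    (l : R -> 'I_m * 'rV[R]_2 -> 'rV[R]_4) : Prop :=
  [/\ pl_homotopy l,
      finite_set (singular_time l) &
      forall t, singular_time l t -> exists x p q,
        only_double_point (l t) x p q /\
        transversal_double_point l t x p q].

Definition arc_with_boundary (m : nat) (J B : set ('I_m * 'rV[R]_2)) : Prop :=
  exists (i : 'I_m) (gamma : 'rV[R]_1 -> 'rV[R]_2),
    [/\ pl_embedding (cube 'rV[R]_1) gamma,
        gamma @` cube 'rV[R]_1 `<=` sphere 1,
        J = [set (i, gamma s) | s in cube 'rV[R]_1] &
        B = [set (i, gamma s) | s in sphere 0]].

Definition null_homotopic_inclusion (A B : set 'rV[R]_4) : Prop :=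
  A `<=` B /\
  exists (H : R^o * 'rV[R]_4 -> 'rV[R]_4) (c : 'rV[R]_4),
    [/\ {within [set z | unit_time z.1 /\ A z.2], continuous H},
        forall (s : R) a, unit_time s -> A a -> B (H (s, a)),
        forall a, A a -> H (0, a) = a &
        forall a, A a -> H (1, a) = c].

Definition strong_quasi_embedding (k m : nat)
    (f : 'I_m * 'rV[R]_2 -> 'rV[R]_4) : Prop :=
  pl_map f /\
  exists x p q, only_double_point f x p q /\
  exists (P : nat -> set 'rV[R]_4) (J : nat -> set ('I_m * 'rV[R]_2)),
    [/\ P 0%N = [set x],
        forall j, (0 < j <= k)%N -> pl_3ball (P j),
        arc_with_boundary (J 0%N) (fiber f [set x]) /\
        (forall j, (j <= k)%N -> exists B, arc_with_boundary (J j) B),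
        forall j, (j <= k)%N -> fiber f (P j) `<=` J j &
        forall j, (j < k)%N ->
          null_homotopic_inclusion (P j `|` f @` J j) (P j.+1)].

Definition strong_quasi_isotopy (k m : nat)
    (l : R -> 'I_m * 'rV[R]_2 -> 'rV[R]_4) : Prop :=
  generic_pl_homotopy l /\
  forall t, singular_time l t -> strong_quasi_embedding k (l t).

End PL.

(* Main.v *)
(* All singular links of an approximation l are localised by nested cubes.
   Compactness makes the isotopy h equicontinuous and equi-injective, uniformly
   in time.  Hence there are scales r_0 <= ... <= r_(k+1) and s_0, ..., s_k such
   that the points of the link whose image is within about r_j of h_t(p) lie on
   the arc of radius s_j around p, while that arc is mapped within r_(j+1) of
   h_t(p).  If l is closer than r_0 / 2 to h, the two preimages of a double point
   of l_t are so close that they bound a short arc J_0, and the cubes of radii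
   r_j around h_t(p) serve as the balls P_j. *)
From HB Require Import structures.
Require Import Defs.
From mathcomp Require Import all_boot all_order all_algebra.
From mathcomp Require Import all_classical all_reals all_analysis.
From mathcomp Require Import lra.
Import Order.TTheory GRing.Theory Num.Theory.
Import numFieldNormedType.Exports.
Local Open Scope classical_set_scope.
Local Open Scope ring_scope.

Set Implicit Arguments.
Unset Strict Implicit.
Unset Printing Implicit Defensive.

(** * Convex polyhedra in coordinate spaces *)

Lemma convex_polyhedron_setI (R : realType) (V : lmodType R) (A B : set V) :
  convex_polyhedron A -> convex_polyhedron B -> convex_polyhedron (A `&` B).
Proof.
move=> [n [a [b ->]]] [n' [a' [b' ->]]].
exists (n + n')%N,
  (fun i => match fintype.split i with inl j => a j | inr j => a' j end),
  (fun i => match fintype.split i with inl j => b j | inr j => b' j end).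
apply/seteqP; split => x /=.
  by move=> [H H'] i; case: (fintype.split i).
move=> H; split=> i.
  by have := H (unsplit (inl i)); rewrite unsplitK.
by have := H (unsplit (inr i)); rewrite unsplitK.
Qed.

Lemma convex_polyhedron_preimage (R : realType) (V W : lmodType R)
    (L : {linear V -> W}) (c : W) (A : set W) :
  convex_polyhedron A -> convex_polyhedron [set x | A (c + L x)].
Proof.
move=> [n [a [b ->]]].
exists n, (fun i => a i \o L : {scalar V}), (fun i => b i - a i c).
by apply/seteqP; split => x /= H i; have := H i; rewrite linearD lerBrDl.
Qed.

Lemma convex_polyhedron_le (R : realType) (V : lmodType R)
    (a : {scalar V}) (b : R) : convex_polyhedron [set x | a x <= b].
Proof.
exists 1%N, (fun=> a), (fun=> b).
by apply/seteqP; split => x /=; [move=> H _ | move/(_ ord0)].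
Qed.

Lemma convex_polyhedron_ge (R : realType) (V : lmodType R)
    (a : {scalar V}) (b : R) : convex_polyhedron [set x | b <= a x].
Proof.
exists 1%N, (fun=> \- a : {scalar V}), (fun=> - b).
apply/seteqP; split => x /=; first by move=> H _; rewrite lerN2.
by move/(_ ord0); rewrite lerN2.
Qed.

Lemma scalar_continuous (R : realType) n (a : {scalar 'rV[R]_n}) :
  continuous (a : 'rV[R]_n -> R).
Proof.
have -> : (a : 'rV[R]_n -> R) = fun x => \sum_j x 0 j * a (delta_mx 0 j).
  apply/funext => x; rewrite {1}(row_sum_delta x) linear_sum.
  by apply: eq_bigr => j _; rewrite linearZ.
have cD : continuous (fun x : R * R => x.1 + x.2) by exact: add_continuous.
apply: (continuous_big cD) => j _ x.
exact: (@cvgMr_tmp R _ (nbhs x) _ _ _ _ (@coord_continuous R 1 n 0 j x)).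
Qed.

Lemma convex_polyhedron_closed (R : realType) (n : nat) (A : set 'rV[R]_n) :
  convex_polyhedron A -> closed A.
Proof.
move=> [m [a [b ->]]].
have -> : [set x | forall i, a i x <= b i] =
    \bigcap_(i in [set: 'I_m]) [set x | a i x <= b i].
  by apply/seteqP; split => x /= H i; [move=> _|]; exact: H.
apply: closed_bigI => i _.
apply: (@preimage_closed _ _ (a i) [set y | y <= b i]); last exact: closed_le.
by move=> x _; exact: scalar_continuous.
Qed.

Lemma rV_norm_leP (R : realType) (n : nat) (x : 'rV[R]_n) (r : R) :
  0 <= r -> reflect (forall j, `|x 0 j| <= r) (`|x| <= r).
Proof.
move=> r0; apply: (iffP idP) => [xr j|H].
  apply: le_trans xr; rewrite /Num.norm/= mx_normrE.
  exact: (le_bigmax _ _ (0, j)).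
rewrite /Num.norm/= mx_normrE; apply: bigmax_le => // -[i j] _ /=.
by rewrite (ord1 i).
Qed.

Lemma convex_polyhedron_bigcap (R : realType) (V : lmodType R) n
    (A : 'I_n -> set V) : (forall i, convex_polyhedron (A i)) ->
  convex_polyhedron (\bigcap_(i in [set: 'I_n]) A i).
Proof.
elim: n A => [|n IH] A hA.
  exists 0%N, (fun=> \0 : {scalar V}), (fun=> 0).
  by apply/seteqP; split => x _ [].
have -> : \bigcap_(i in [set: 'I_n.+1]) A i =
    A ord0 `&` \bigcap_(i in [set: 'I_n]) A (lift ord0 i).
  apply/seteqP; split => x.
    by move=> H; split; [exact: H | move=> i _; exact: H].
  move=> [H0 H] i _; case: (unliftP ord0 i) => [j ->|->] //; exact: H.
by apply: convex_polyhedron_setI => //; apply: IH.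
Qed.

(** Coordinates are named so that they can carry a linear structure and serve as the functionals of
    a [convex_polyhedron]. *)
Definition rV_coord (R : realType) n (j : 'I_n) (x : 'rV[R]_n) : R := x 0 j.
Lemma rV_coord_is_linear (R : realType) n (j : 'I_n) :
  scalar (@rV_coord R n j : 'rV[R]_n -> R).
Proof. by move=> a x y; rewrite /rV_coord !mxE. Qed.
HB.instance Definition _ (R : realType) n (j : 'I_n) :=
  GRing.isLinear.Build R 'rV[R]_n R _ (@rV_coord R n j)
    (@rV_coord_is_linear R n j).

Lemma convex_polyhedron_ball (R : realType) (n : nat) (r : R) : 0 <= r ->
  convex_polyhedron [set x : 'rV[R]_n | `|x| <= r].
Proof.
move=> r0.
have -> : [set x : 'rV[R]_n | `|x| <= r] =
    \bigcap_(j in [set: 'I_n])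
      ([set x | rV_coord j x <= r] `&` [set x | - r <= rV_coord j x]).
  apply/seteqP; split => x /=.
    by move=> /rV_norm_leP H j _; have := H r0 j; rewrite ler_norml => /andP[].
  by move=> H; apply/rV_norm_leP => // j; have [h1 h2] := H j I;
    rewrite ler_norml h1 h2.
apply: convex_polyhedron_bigcap => j.
by apply: convex_polyhedron_setI;
  [exact: convex_polyhedron_le | exact: convex_polyhedron_ge].
Qed.

(** * Restriction and affine change of variables for PL maps *)

Lemma pl_on_setI (R : realType) (V W : lmodType R) (K Q : set V) (f : V -> W) :
  convex_polyhedron Q -> pl_on K f -> pl_on (K `&` Q) f.
Proof.
move=> hQ [n [C [hC -> hf]]]; exists n, (fun i => C i `&` Q); split.
- by move=> i; exact: convex_polyhedron_setI.
- by rewrite setI_bigcupl.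
- by move=> i x y s [xC _] [yC _]; exact: (hf i).
Qed.

Lemma pl_on_affine_comp (R : realType) (U V W : lmodType R)
    (L : {linear U -> V}) (c : V) (K : set V) (f : V -> W) :
  pl_on K f -> pl_on [set x | K (c + L x)] (fun x => f (c + L x)).
Proof.
move=> [n [C [hC -> hf]]]; exists n, (fun i => [set x | C i (c + L x)]); split.
- by move=> i; exact: convex_polyhedron_preimage.
- by apply/seteqP; split => x [i _ H]; exists i.
- move=> i x y s xC yC s01; rewrite -(hf i) //; congr f.
  rewrite linearD !linearZ !scalerDr addrACA; congr (_ + _).
  by rewrite -scalerDl addrC subrK scale1r.
Qed.

Lemma pl_on_linear_comp (R : realType) (U V W : lmodType R)
    (L : {linear V -> W}) (K : set U) (f : U -> V) :
  pl_on K f -> pl_on K (fun x => L (f x)).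
Proof.
move=> [n [C [hC -> hf]]]; exists n, C; split => //.
by move=> i x y s xC yC s01; rewrite (hf i) // linearD !linearZ.
Qed.

(** * PL arc charts on the boundary of the square *)

Definition rV2 (R : realType) (a b : R) : 'rV[R]_2 :=
  \row_j (if j == 0 then a else b).

Lemma rV2_eta (R : realType) (u : 'rV[R]_2) : u = rV2 (u 0 0) (u 0 1).
Proof.
apply/rowP => j; rewrite mxE; case: ifP => [/eqP -> //|].
by case: j => [[|[|//]] ij] //= _; congr (u 0 _); apply/val_inj.
Qed.

Lemma rV2_norm_leE (R : realType) (u : 'rV[R]_2) (r : R) : 0 <= r ->
  (`|u| <= r) = (`|u 0 0| <= r) && (`|u 0 1| <= r).
Proof.
move=> r0; apply/(rV_norm_leP _ r0)/andP; first by move=> H; split; exact: H.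
move=> [h0 h1] [[|[|//]] ij].
  by rewrite (_ : Ordinal ij = 0) //; apply/val_inj.
by rewrite (_ : Ordinal ij = 1) //; apply/val_inj.
Qed.

Lemma rV2_norm (R : realType) (u : 'rV[R]_2) :
  `|u| = Num.max `|u 0 0| `|u 0 1|.
Proof.
have m0 : 0 <= Num.max `|u 0 0| `|u 0 1| by rewrite le_max normr_ge0.
apply/eqP; rewrite eq_le rV2_norm_leE // !le_max !lexx orbT /=.
have : `|u| <= `|u| by []; rewrite {1}rV2_norm_leE //.
by rewrite ge_max.
Qed.

(* The right-hand side of the square together with the horizontal sides, the
   latter prolonged to infinite rays so that the map is injective on the line. *)
Definition side (R : realType) (s : R) : 'rV[R]_2 :=
  if s <= -1 then rV2 (2 + s) (-1) else
  if s <= 1 then rV2 1 s else rV2 (2 - s) 1.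

Lemma side_cases (R : realType) (s : R) :
  [\/ s <= -1 /\ side s = rV2 (2 + s) (-1),
      -1 <= s <= 1 /\ side s = rV2 1 s |
      1 <= s /\ side s = rV2 (2 - s) 1].
Proof.
rewrite /side; case: (leP s (-1)) => s1; first by apply: Or31.
case: (leP s 1) => s2; last by apply: Or33; split=> //; exact: ltW.
by apply: Or32; split=> //; rewrite ltW.
Qed.

Lemma side_le (R : realType) (s : R) : s <= -1 -> side s = rV2 (2 + s) (-1).
Proof. by rewrite /side => ->. Qed.

Lemma side_mid (R : realType) (s : R) : -1 <= s <= 1 -> side s = rV2 1 s.
Proof. by case: (side_cases s) => -[h ->] // ?; congr rV2; lra. Qed.

Lemma side_ge (R : realType) (s : R) : 1 <= s -> side s = rV2 (2 - s) 1.
Proof. by case: (side_cases s) => -[h ->] // ?; congr rV2; lra. Qed.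

Lemma rV2E (R : realType) (a b : R) : (rV2 a b 0 0 = a) * (rV2 a b 0 1 = b).
Proof. by split; rewrite mxE. Qed.

Lemma rV2B (R : realType) (u v : 'rV[R]_2) j : (u - v) 0 j = u 0 j - v 0 j.
Proof. by rewrite !mxE. Qed.

Lemma rV2_inj (R : realType) (a b c d : R) :
  rV2 a b = rV2 c d -> a = c /\ b = d.
Proof.
move=> e; split.
  by have := congr1 (fun u : 'rV[R]_2 => u 0 0) e; rewrite !rV2E.
by have := congr1 (fun u : 'rV[R]_2 => u 0 1) e; rewrite !rV2E.
Qed.

Lemma side_inj (R : realType) : injective (@side R).
Proof.
move=> s s'.
by case: (side_cases s) => -[h ->]; case: (side_cases s') => -[h' ->]
  => /rV2_inj[]; lra.
Qed.

Lemma side_norm (R : realType) (s : R) : `|s| <= 3 -> `|side s| = 1.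
Proof.
rewrite ler_norml => s3; apply/eqP; rewrite rV2_norm eq_le ge_max le_max.
case: (side_cases s) => -[h ->];
  rewrite !rV2E ?normrN ?normr1 !ler_norml lexx ?orbT ?andbT //; lra.
Qed.

Lemma side_lipschitz (R : realType) (s s' : R) :
  `|side s - side s'| <= `|s - s'|.
Proof.
wlog ss' : s s' / s <= s'.
  move=> H; case: (leP s s') => [|/ltW]; first exact: H.
  by move=> /H; rewrite distrC (distrC s).
rewrite rV2_norm_leE // (distrC s) (ger0_norm (_ : 0 <= s' - s)) ?subr_ge0 //.
rewrite !rV2B.
case: (side_cases s) => -[h ->]; case: (side_cases s') => -[h' ->];
  rewrite !rV2E !ler_norml; lra.
Qed.

(** A point [u] of the square this close to its right side has first coordinate at least 1/2, so it
    lies in the image of [side]. Passing a corner adds the two coordinate differences, each at most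
    the max-norm distance; hence the factor 2. *)
Lemma side_surj (R : realType) (a : R) (u : 'rV[R]_2) : -1 <= a <= 1 ->
  `|u| = 1 -> `|u - side a| <= 1 / 2 ->
  exists b, u = side (a + b) /\ `|b| <= 2 * `|u - side a|.
Proof.
move=> a1 u1; have -> : side a = rV2 1 a.
  case: (side_cases a) => -[h ->] //; congr rV2; lra.
have : `|u| <= 1 by rewrite u1.
rewrite rV2_norm_leE // !ler_norml => /andP[x1 y1].
have n0 : 0 <= `|u - rV2 1 a| by [].
have := lexx `|u - rV2 1 a|; rewrite {1}rV2_norm_leE // !rV2B !rV2E.
move: u1 (rV2_eta u) n0; rewrite rV2_norm.
move: `|u - _| (u 0 0) (u 0 1) x1 y1 => d x y x1 y1 xy1 -> {u} d0.
rewrite !ler_norml => /andP[xd yd] d2.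
have [x_1|x_1] := eqVneq x 1.
  exists (y - a); rewrite x_1 subrKC; split; last by rewrite ler_norml; lra.
  by case: (side_cases y) => -[h ->] //; congr rV2; lra.
have x0 : x < 1 by rewrite lt_neqAle x_1; lra.
have : `|y| = 1.
  move: xy1; rewrite ger0_norm; last lra.
  by rewrite /Num.max; case: ifP => // _ xx; rewrite xx ltxx in x0.
move/eqP; rewrite eqr_norml ler01 andbT => /orP[]/eqP yE; subst y.
  exists (2 - x - a); rewrite subrKC; split; last by rewrite ler_norml; lra.
  by case: (side_cases (2 - x)) => -[h ->]; congr rV2; lra.
exists (x - 2 - a); rewrite subrKC; split; last by rewrite ler_norml; lra.
by case: (side_cases (x - 2)) => -[h ->]; congr rV2; lra.
Qed.

Lemma side_pl (R : realType) :
  pl_on [set: 'rV[R]_1] (fun x : 'rV[R]_1 => side (x 0 0)).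
Proof.
pose a := @rV_coord R 1 ord0 : {scalar 'rV[R]_1}.
pose C (i : 'I_3) : set 'rV[R]_1 := match val i with
  | 0%N => [set x | a x <= -1]
  | 1%N => [set x | -1 <= a x] `&` [set x | a x <= 1]
  | _ => [set x | 1 <= a x] end.
exists 3%N, C; split.
- move=> [[|[|[|//]]] ij]; rewrite /C /=.
  + exact: convex_polyhedron_le.
  + by apply: convex_polyhedron_setI;
      [exact: convex_polyhedron_ge | exact: convex_polyhedron_le].
  + exact: convex_polyhedron_ge.
- apply/seteqP; split => // x _.
  have e : x 0 0 = a x by [].
  case: (side_cases (x 0 0)) => -[]; rewrite e => h _.
  + by exists ord0.
  + by exists (lift ord0 ord0) => //; case/andP: h.
  + by exists ord_max.
- move=> [[|[|[|//]]] ij] x y s; rewrite /C /= /a /= /rV_coord => hx hy s01;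
    rewrite !mxE; apply/rowP => j; move: hx hy;
    move: (x _ _) (y _ _) => {}x {}y.
  + move=> hx hy; rewrite !side_le ?(hx, hy) //; last nra.
    by rewrite !mxE; case: ifP => _; lra.
  + move=> [hx hx'] [hy hy']; rewrite !side_mid ?hx ?hx' ?hy ?hy' //; last nra.
    by rewrite !mxE; case: ifP => _; lra.
  + move=> hx hy; rewrite !side_ge ?(hx, hy) //; last nra.
    by rewrite !mxE; case: ifP => _; lra.
Qed.

(** For [e] equal to 1 or -1 these are four symmetries of the square, all involutions, and they
    suffice to carry any side to the right one. *)
Definition square_sym (R : realType) (sw : bool) (e : R) (u : 'rV[R]_2) :
    'rV[R]_2 :=
  \row_j (e * u 0 (if sw then rev_ord j else j)).

Lemma square_sym_is_linear (R : realType) (sw : bool) (e : R) :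
  linear (@square_sym R sw e).
Proof. by move=> a u v; apply/rowP => j; rewrite !mxE mulrDr mulrCA. Qed.
HB.instance Definition _ (R : realType) (sw : bool) (e : R) :=
  GRing.isLinear.Build R 'rV[R]_2 'rV[R]_2 _ (@square_sym R sw e)
    (@square_sym_is_linear R sw e).

Lemma square_symK (R : realType) (sw : bool) (e : R) : `|e| = 1 ->
  involutive (square_sym sw e).
Proof.
move=> e1 u; apply/rowP => j; rewrite !mxE mulrA -expr2.
rewrite -real_normK ?num_real //; rewrite e1 expr1n mul1r.
by case: sw; rewrite ?rev_ordK.
Qed.

Lemma square_sym_norm (R : realType) (sw : bool) (e : R) (u : 'rV[R]_2) :
  `|e| = 1 -> `|square_sym sw e u| = `|u|.
Proof.
move=> e1.
have le v : `|square_sym sw e v| <= `|v|.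
  apply/rV_norm_leP => // j; rewrite mxE normrM e1 mul1r.
  exact/(rV_norm_leP _ (normr_ge0 v)).
by apply/eqP; rewrite eq_le le /= -{1}(square_symK sw e1 u).
Qed.

(** A symmetry of the square moves [p] to the right side, where [side], recentred at the parameter
    [a] of the image of [p], is the chart. Around [p], arcs become intervals of parameters. *)
Lemma sphere1_chart (R : realType) (p : 'rV[R]_2) : `|p| = 1 ->
  exists W : R -> 'rV[R]_2,
   [/\ W 0 = p,
       injective W /\ pl_on [set: 'rV[R]_1] (fun x : 'rV[R]_1 => W (x 0 0)),
       forall s, `|s| <= 1 -> `|W s| = 1,
       forall s s', `|W s - W s'| <= `|s - s'| &
       forall u, `|u| = 1 -> `|u - p| <= 1 / 2 ->
         exists b, u = W b /\ `|b| <= 2 * `|u - p|].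
Proof.
move=> p1.
(* A coordinate of [p] equal to 1 or -1 serves as [e], and [sw] brings it to the front, where it
   becomes its own square. *)
have [sw [e [e1 E]]] : exists sw e, `|e| = 1 /\ (square_sym sw e p) 0 0 = 1.
  have : `|p 0 0| = 1 \/ `|p 0 1| = 1.
    move: p1; rewrite rV2_norm /Num.max.
    by case: ifP => _; [right | left].
  have sq (x : R) : `|x| = 1 -> x * x = 1.
    by move=> x1; rewrite -expr2 -real_normK ?num_real // x1 expr1n.
  case=> h; [exists false, (p 0 0) | exists true, (p 0 1)]; split=> //;
    rewrite mxE ?sq // (_ : rev_ord _ = 1) ?sq //; exact/val_inj.
pose T := square_sym sw e; pose a := T p 0 1.
have TK : involutive T by exact: square_symK.
have TN u : `|T u| = `|u| by exact: square_sym_norm.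
have TB u v : T u - T v = T (u - v) by rewrite /T linearB.
have a1 : -1 <= a <= 1.
  rewrite -ler_norml; have := lexx `|T p|.
  by rewrite {1}rV2_norm_leE // TN p1 => /andP[].
have sa : side a = T p.
  by rewrite side_mid // (rV2_eta (T p)) E.
exists (fun s => T (side (a + s))); split.
- by rewrite addr0 sa TK.
- split; first by move=> s s' /(inv_inj TK) /side_inj /addrI.
  apply: pl_on_linear_comp.
  have := pl_on_affine_comp idfun (const_mx a) (@side_pl R).
  congr (pl_on _ _).
  by apply/funext => x /=; rewrite !mxE.
- move=> s; rewrite TN ler_norml => s1; apply: side_norm; rewrite ler_norml.
  lra.
- move=> s s'; rewrite TB TN; apply: le_trans (side_lipschitz _ _) _.
  by rewrite opprD addrACA subrr add0r.
- move=> u u1 up.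
  have [] := @side_surj R a (T u) a1; rewrite ?sa ?TB ?TN //.
  move=> b [Tu hb]; exists b; split=> //.
  by rewrite -Tu TK.
Qed.

(** * Continuity of the PL identification of the 3-space with the punctured 3-sphere *)

(** Continuity of [g] at [y] makes [g y] a cluster value of [m], because [g] undoes [f]; as [m]
    converges to [u] in a Hausdorff space, [g y] is [u]. *)
Lemma cluster_left_inverse (X : Type) (T U : topologicalType) (f : T -> U)
    (g : U -> T) (m : X -> T) (F : set_system X) (u : T) (y : U) :
  hausdorff_space T -> Filter F -> cancel f g ->
  {within range f, continuous g} -> m @ F --> u -> range f y ->
  cluster ((f \o m) @ F) y -> y = f u.
Proof.
move=> hT FF fK /subspace_continuousP gc mu [v _ <-] clv; congr f; apply: hT.
move=> A B vA uB.
have gA : within (range f) (nbhs (f v)) (g @^-1` A).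
  have rv : range f (f v) by exists v.
  by have := gc _ rv; rewrite /from_subspace fK; apply.
have mB : ((f \o m) @ F) (f @` B).
  have := mu _ uB; rewrite /= /nbhs /=; apply: filterS => x /= Bx.
  by exists (m x).
have [_ [[b Bb <-] /= Ab]] := clv _ _ mB gA.
by exists b; split=> //; rewrite -(fK b); apply: Ab; exists b.
Qed.

Lemma cluster_continuous (T U : topologicalType) (M : T -> U) (F : set_system T)
    (y : T) : {for y, continuous M} -> cluster F y -> cluster (M @ F) (M y).
Proof.
move=> cM cl A B FA yB.
by have [z [Az Bz]] := cl _ _ FA (cM _ yB); exists (M z).
Qed.

Lemma rV_norm_compact (R : realType) n (r : R) :
  compact [set x : 'rV[R]_n | `|x| <= r].
Proof.
apply: bounded_closed_compact.
  exists r; split=> [|s rs x /= xr]; first exact: num_real.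
  by rewrite (le_trans xr) // ltW.
apply: (@preimage_closed _ R (fun x : 'rV[R]_n => `|x|) [set y | y <= r]).
  by move=> x _; exact: norm_continuous.
exact: closed_le.
Qed.

Lemma sphere_closed (R : realType) n : closed (@sphere R n).
Proof.
apply: (@preimage_closed _ R (fun x : 'rV[R]_n.+1 => `|x|) [set y | y = 1]).
  by move=> x _; exact: norm_continuous.
exact: closed_eq.
Qed.

(** The midpoint, with its weights written as in [affine_on]. *)
Definition half_comb (R : realType) (V : lmodType R) (a b : V) : V :=
  (2^-1 : R) *: a + (1 - 2^-1 : R) *: b.

Lemma half_combxx (R : realType) (V : lmodType R) (a : V) : half_comb a a = a.
Proof. by rewrite /half_comb -scalerDl subrKC scale1r. Qed.

Lemma half_combl (R : realType) (V : lmodType R) (a b : V) :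
  half_comb a b = a -> a = b.
Proof.
have h : (1 - 2^-1 : R) != 0 by apply: lt0r_neq0; lra.
by rewrite -[X in _ = X]half_combxx => /addrI /(scalerI h).
Qed.

Lemma half_combr (R : realType) (V : lmodType R) (a b : V) :
  half_comb a b = b -> a = b.
Proof.
have h : (2^-1 : R) != 0 by apply: lt0r_neq0; lra.
by rewrite -[X in _ = X]half_combxx => /addIr /(scalerI h).
Qed.

Lemma half_comb_cvg (R : realType) (V : normedModType R) (X : Type)
    (F : set_system X) (f : X -> V) (a b : V) : Filter F ->
  f @ F --> a -> half_comb (f x) b @[x --> F] --> half_comb a b.
Proof.
by move=> FF fa; apply: cvgD; [exact: cvgZl_tmp | exact: cvg_cst].
Qed.

Lemma rV_near_norm (R : realType) n (u : 'rV[R]_n) :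
  \forall x \near u, `|x| <= 1 + `|u|.
Proof.
near=> x; have : `|u - x| < 1.
  near: x; exact: (@cvgr_dist_lt _ _ _ (nbhs u) _ _ _ cvg_id _ ltr01).
have := ler_distD u x 0; rewrite !subr0 distrC; lra.
Unshelve. all: by end_near. Qed.

(* The only possible cluster value outside the range is the missing point pt.
   It is excluded by affinity: the midpoint of pt and iota u lies in the range,
   hence equals iota u. *)
Lemma pl_R3_in_S3_cvg (R : realType) (iota : 'rV[R]_3 -> 'rV[R]_4)
    (C : set 'rV[R]_3) (u : 'rV[R]_3) :
  pl_R3_in_S3 iota -> affine_on C iota -> C u ->
  iota x @[x --> within C (nbhs u)] --> iota u.
Proof.
move=> iotaP aff Cu; have [_ [pt _ rng] [g gK gc]] := iotaP.
have io_sph x : @sphere R 3 (iota x).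
  have : range iota (iota x) by exists x.
  by rewrite rng => -[].
have PF : ProperFilter (within C (nbhs u)).
  by apply: within_nbhs_proper; exact: subset_closure.
set F := within C (nbhs u).
have Fsph : F (iota @^-1` [set y | `|y| <= 2]).
  by apply: filterE => x /=; rewrite (io_sph x) ler1n.
have cl_uniq y : cluster (iota @ F) y -> y = iota u.
  move=> cl.
  have in_sph z m : cluster ((iota \o m) @ F) z -> @sphere R 3 z.
    move=> clz; apply: sphere_closed => B zB.
    have Fs : F ((iota \o m) @^-1` @sphere R 3).
      by apply: filterE => x; exact: io_sph.
    by have [w [? ?]] := clz _ _ Fs zB; exists w.
  have hT : hausdorff_space 'rV[R]_3 by exact: norm_hausdorff.
  have ysph : @sphere R 3 y by exact: (in_sph y id).
  have Fu : F --> u by exact: cvg_within.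
  have [ypt|ynpt] := pselect (y = pt); last first.
    apply: (cluster_left_inverse hT (within_filter _ _) gK gc Fu _ cl).
    by rewrite rng.
  have cM : {for y, continuous (fun z : 'rV[R]_4 => half_comb z (iota u))}.
    exact: half_comb_cvg cvg_id.
  have clM : cluster ((iota \o (fun x : 'rV[R]_3 => half_comb x u)) @ F)
      (half_comb (y : 'rV[R]_4) (iota u)).
    move=> A B FA yB; apply: (cluster_continuous cM cl) => //.
    apply: (@filterS _ (nbhs u) _ (fun x => C x -> A (iota (half_comb x u))));
      last exact: FA.
    move=> x h Cx.
    by have := h Cx; rewrite /= aff //; lra.
  apply: half_combr.
  apply: (cluster_left_inverse hT (within_filter _ _) gK gc _ _ clM).
    rewrite -[X in _ --> X](half_combxx u).
    exact: half_comb_cvg.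
  rewrite rng; split; first exact: in_sph clM.
  rewrite -ypt => /half_combl yu.
  have : range iota (iota u) by exists u.
  by rewrite rng -yu ypt => -[_]; apply.
(* The values stay in a compact ball, so a unique cluster value is a limit. *)
apply: (compact_cluster_set1 _ (@rV_norm_compact R 4 2) _ _ Fsph).
- exact: norm_hausdorff.
- apply: filterS (rV_near_norm (iota u)) => y.
  by rewrite (io_sph u).
- apply/seteqP; split => y; first exact: cl_uniq.
  move=> ->.
  have [q [_ clq]] := rV_norm_compact (fmap_proper_filter iota PF) Fsph.
  by rewrite -(cl_uniq q).
Qed.

(** Near [u] finitely many closed pieces cover the space. A piece that misses [u] misses a
    neighbourhood of [u], and along each piece through [u] the map converges to its value at [u]. *)
Lemma pl_R3_in_S3_continuous (R : realType) (iota : 'rV[R]_3 -> 'rV[R]_4) :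
  pl_R3_in_S3 iota -> continuous iota.
Proof.
move=> iotaP u V uV.
have [/(_ (`|u| + 1)) [n [C [Cpoly Ccov Caff]]] _ _] := iotaP.
have hC i : \forall x \near u, C i x -> V (iota x).
  have [Cu|Cu] := pselect (C i u).
    exact: (pl_R3_in_S3_cvg iotaP (Caff i) Cu uV).
  have := closed_openC (convex_polyhedron_closed (Cpoly i)).
  rewrite openE => /(_ u Cu); apply: filterS => x nC /nC; exact.
have hB : \forall x \near u, `|x| <= `|u| + 1.
  by apply: filterS (rV_near_norm u) => x; rewrite addrC.
suff : \forall x \near u, V (iota x) by [].
near=> x.
have : [set x : 'rV[R]_3 | `|x| <= `|u| + 1] x by near: x.
rewrite Ccov => -[i _ Cix]; move: i Cix; near: x.
by apply: filter_forall.
Unshelve. all: by end_near. Qed.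

(** * Compactness: uniform estimates for a topological isotopy *)

(** Turns a pointwise implication into a uniform one. It is applied with [D] and [e] the distances
    in the source and the target of the isotopy, in either order. *)
Lemma compact_gap (T : topologicalType) (R : realType) (K : set T)
    (D e : T -> R) (s : R) :
  compact K -> {within K, continuous D} -> {within K, continuous e} ->
  (forall x, K x -> 0 <= D x) -> (forall x, K x -> D x = 0 -> e x < s) ->
  exists2 d, 0 < d & forall x, K x -> D x < d -> e x < s.
Proof.
move=> cK cD ce D0 De.
have [K0|K0] := pselect (K !=set0); last first.
  by exists 1 => // x Kx; exfalso; apply: K0; exists x.
(* [D] plus twice the positive part of [s - e] is continuous and positive. *)
pose H x := D x + (`|s - e x| + (s - e x)).
have cH : {within K, continuous H}.
  apply/subspace_continuousP => x Kx.
  move/subspace_continuousP : cD => /(_ x Kx) cD.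
  move/subspace_continuousP : ce => /(_ x Kx) ce.
  have cse : s - e y @[y --> within K (nbhs x)] --> s - e x.
    by apply: cvgB => //; exact: cvg_cst.
  by apply: cvgD => //; apply: cvgD => //; exact: cvg_norm.
have [c /set_mem Kc cmin] := compact_EVT_min K0 cK cH.
exists (H c).
  have := D0 c Kc; have := De c Kc; rewrite /H; case: (ltP 0 (D c)) => h1 h2 h3.
    by have := ler_norm (e c - s); rewrite distrC; lra.
  have h4 : D c = 0 by apply/eqP; rewrite eq_le h1.
  by have := h2 h4; have : 0 <= `|s - e c| by []; lra.
(* Where [s <= e x] the positive part vanishes, so [H x = D x], which cannot be below the minimum
   [H c]. *)
move=> x Kx; rewrite ltNge => /negP xc.
rewrite ltNge; apply/negP => se; apply: xc.
by have := cmin x (mem_set Kx); rewrite {2}/H ler0_norm; lra.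
Qed.

Lemma finite_uniform (R : realType) (I : finType) (P : I -> R -> Prop) :
  (forall i d d', P i d -> d' <= d -> P i d') ->
  (forall i, exists2 d, 0 < d & P i d) ->
  exists2 d, 0 < d & forall i, P i d.
Proof.
move=> mono ex.
have /choice [d hd] : forall i, exists d, 0 < d /\ P i d.
  by move=> i; have [d d0 Pd] := ex i; exists d.
(* The initial value 1 keeps the minimum positive when there is no index. *)
exists (\big[Order.min/1]_i d i); last first.
  by move=> i; apply: mono (hd i).2 _; exact: bigmin_le_cond.
by apply: lt_bigmin => [|i _]; [exact: ltr01 | exact: (hd i).1].
Qed.

Lemma within_continuous_map (S T U : topologicalType) (K : set S) (A : set T)
    (p : S -> T) (f : T -> U) :
  continuous p -> (forall x, K x -> A (p x)) -> {within A, continuous f} ->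
  {within K, continuous (f \o p)}.
Proof.
move=> cp KA /subspace_continuousP cf; apply/subspace_continuousP => x Kx B.
move=> /(cf _ (KA x Kx)) h.
apply: (@filterS _ (nbhs x) _ _ _ _ (cp x _ h)) => y /= hy /KA.
exact: hy.
Qed.

Lemma fst_continuous (S T : topologicalType) : continuous (@fst S T).
Proof. by move=> z; exact: cvg_fst. Qed.

Lemma snd_continuous (S T : topologicalType) : continuous (@snd S T).
Proof. by move=> z; exact: cvg_snd. Qed.

Lemma continuous_pair (S T U : topologicalType) (f : S -> T) (g : S -> U) :
  continuous f -> continuous g -> continuous (fun z => (f z, g z)).
Proof. by move=> cf cg z; exact: (cvg_pair (cf z) (cg z)). Qed.

(** The compact space on which distances are compared. Component indices are left out: they are
    finitely many and are handled by [finite_uniform]. *)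
Definition timed_pairs (R : realType) : set ((R^o * 'rV[R]_2) * 'rV[R]_2) :=
  [set z | [/\ unit_time z.1.1, `|z.1.2| = 1 & `|z.2| = 1]].

Lemma timed_pairs_compact (R : realType) : compact (@timed_pairs R).
Proof.
have -> : @timed_pairs R =
    ([set t : R^o | 0 <= t <= 1] `*` @sphere R 1) `*` @sphere R 1.
  by apply/seteqP; split => -[[t u] v] /=; [case | case=> -[]].
have cS : compact (@sphere R 1).
  apply: (subclosed_compact (@sphere_closed R 1) (@rV_norm_compact R 2 1)).
  by move=> x /= ->.
apply: compact_setX => //; apply: compact_setX => //.
have -> : [set t : R^o | 0 <= t <= 1] = [set` `[0 : R, 1]].
  by apply/seteqP; split => t /=; rewrite in_itv.
exact: segment_compact.
Qed.

Lemma top_isotopy_dist_continuous (R : realType) (m n : nat)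
    (h : R -> 'I_m * 'rV[R]_2 -> 'rV[R]_n) i j :
  top_isotopy h -> {within @timed_pairs R, continuous
  (fun z => `|h z.1.1 (i, z.1.2) - h z.1.1 (j, z.2)|)}.
Proof.
move=> hP.
have hi : {within @timed_pairs R, continuous (fun z => h z.1.1 (i, z.1.2))}.
  apply: (@within_continuous_map _ _ _ _ (@annulus R) fst _ _ _ (hP.1 i)).
    exact: fst_continuous.
  by move=> z [].
have hj : {within @timed_pairs R, continuous (fun z => h z.1.1 (j, z.2))}.
  apply: (@within_continuous_map _ _ _ _ (@annulus R) (fun z => (z.1.1, z.2))
     _ _ _ (hP.1 j)).
    apply: continuous_pair; last exact: snd_continuous.
    by move=> z; apply: continuous_comp; exact: fst_continuous.
  by move=> z [].
apply/subspace_continuousP => z Kz.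
apply: cvg_norm; apply: cvgB.
  by move/subspace_continuousP : hi => /(_ z Kz).
by move/subspace_continuousP : hj => /(_ z Kz).
Qed.

Lemma timed_pairs_dist_continuous (R : realType) :
  {within @timed_pairs R, continuous (fun z => `|z.1.2 - z.2|)}.
Proof.
apply: continuous_subspaceT => z.
apply: cvg_norm; apply: cvgB; last exact: snd_continuous.
by apply: continuous_comp; [exact: fst_continuous | exact: snd_continuous].
Qed.

Lemma top_isotopy_equicontinuous (R : realType) (m n : nat)
    (h : R -> 'I_m * 'rV[R]_2 -> 'rV[R]_n) (r : R) :
  top_isotopy h -> 0 < r ->
  exists2 s, 0 < s & forall i t u v, unit_time t -> `|u| = 1 -> `|v| = 1 ->
    `|u - v| < s -> `|h t (i, u) - h t (i, v)| < r.
Proof.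
move=> hP r0; apply: finite_uniform => [i d d' H d'd t u v ht hu hv uv|i].
  by apply: H => //; exact: lt_le_trans uv d'd.
have [] := @compact_gap _ R (@timed_pairs R) _ _ r (@timed_pairs_compact R)
    (@timed_pairs_dist_continuous R)
    (@top_isotopy_dist_continuous _ _ _ _ i i hP).
- by [].
- move=> [[t u] v] /= _ /eqP; rewrite normr_eq0 subr_eq0 => /eqP ->.
  by rewrite subrr normr0.
- move=> d d0 H; exists d => // t u v ht hu hv uv.
  exact: (H ((t, u), v)).
Qed.

(** The converse estimate to equicontinuity: by injectivity of each [h t], the target distance
    vanishes only at coinciding points. *)
Lemma top_isotopy_separation (R : realType) (m n : nat)
    (h : R -> 'I_m * 'rV[R]_2 -> 'rV[R]_n) (s : R) :
  top_isotopy h -> 0 < s ->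
  exists2 d, 0 < d & forall i j t u v, unit_time t -> `|u| = 1 -> `|v| = 1 ->
    `|h t (i, u) - h t (j, v)| < d -> i = j /\ `|u - v| < s.
Proof.
move=> hP s0.
suff [d d0 H] : exists2 d, 0 < d & forall ij : 'I_m * 'I_m,
    forall t u v, unit_time t -> `|u| = 1 -> `|v| = 1 ->
    `|h t (ij.1, u) - h t (ij.2, v)| < d -> ij.1 = ij.2 /\ `|u - v| < s.
  by exists d => // i j; exact: (H (i, j)).
apply: finite_uniform => [ij d d' H d'd t u v ht hu hv uv|[i j] /=].
  by apply: (H t) => //; exact: lt_le_trans uv d'd.
(* On distinct components [e] is constantly [s], so that [e z < s] also forces [i = j]. *)
pose e (z : (R^o * 'rV[R]_2) * 'rV[R]_2) :=
  if i == j then `|z.1.2 - z.2| else s.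
have ce : {within @timed_pairs R, continuous e}.
  rewrite /e; case: (i == j); first exact: timed_pairs_dist_continuous.
  by apply: continuous_subspaceT => z; exact: cvg_cst.
have [] := @compact_gap _ R (@timed_pairs R) _ _ s (@timed_pairs_compact R) 
    (@top_isotopy_dist_continuous _ _ _ _ i j hP) ce.
- by [].
- move=> [[t u] v] [/= ht hu hv] /eqP; rewrite normr_eq0 subr_eq0 => /eqP huv.
  have := hP.2 t ht (i, u) (j, v); rewrite !inE => /(_ hu hv huv) [ij uv].
  by rewrite /e /= ij uv eqxx subrr normr0.
- move=> d d0 H; exists d => // t u v ht hu hv uv.
  have /= := H ((t, u), v) (And3 ht hu hv) uv.
  by rewrite /e /=; case: eqP => [ij|_ ] //; rewrite ltxx.
Qed.

(** * Cubes as PL balls, and contractions inside them *)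

Definition cube_at (R : realType) n (c : 'rV[R]_n) (r : R) : set 'rV[R]_n :=
  [set y | `|y - c| <= r].

Lemma pl_3ball_cube_at (R : realType) (iota : 'rV[R]_3 -> 'rV[R]_4)
    (c : 'rV[R]_3) (r : R) :
  pl_R3_in_S3 iota -> 0 < r -> pl_3ball (iota @` cube_at c r).
Proof.
move=> [iota_pl [pt _ rng] [g gK _]] r0.
have rN0 : r != 0 by exact: lt0r_neq0.
exists (fun x => iota (c + r *: x)); split; first split.
(* The cube of radius [|c| + r] around 0 contains the cube of radius [r] around [c], so PL on the
   former is enough. *)
- have := pl_on_setI (convex_polyhedron_ball 3 ler01)
    (pl_on_affine_comp (GRing.scale r : {linear 'rV[R]_3 -> 'rV[R]_3}) c
      (iota_pl (`|c| + r))).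
  congr (pl_on _ _); apply/seteqP; split => x /=; first by case.
  move=> x1; split=> //; apply: le_trans (ler_normD _ _) _.
  by rewrite lerD2l normrZ gtr0_norm // ger_pMr.
- move=> x y _ _ /(can_inj gK) /addrI /(scalerI rN0); exact.
- apply/seteqP; split => [_ [x x1 <-]|_ [y yc <-]].
    exists (c + r *: x) => //.
    by rewrite /cube_at /= addrC addKr normrZ gtr0_norm // ger_pMr.
  exists (r^-1 *: (y - c)); last by rewrite scalerA divff // scale1r subrKC.
  by rewrite /cube /= normrZ gtr0_norm ?invr_gt0 // ler_pdivrMl // mulr1.
- move=> _ [y _ <-]; have : range iota (iota y) by exists y.
  by rewrite rng => -[].
Qed.

(** The straight-line contraction to [c], conjugated by [iota]; it stays in the cube by
    convexity. *)
Lemma null_homotopic_in_cube_at (R : realType) (iota : 'rV[R]_3 -> 'rV[R]_4)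
    (c : 'rV[R]_3) (r : R) (A : set 'rV[R]_4) :
  pl_R3_in_S3 iota -> A `<=` iota @` cube_at c r ->
  null_homotopic_inclusion A (iota @` cube_at c r).
Proof.
move=> iotaP sA; split=> //.
have [_ _ [g gK gc]] := iotaP.
have Arng : A `<=` range iota by move=> a /sA [y _ <-]; exists y.
exists (fun z => iota ((1 - z.1) *: g z.2 + z.1 *: c)), (iota c); split.
- apply/subspace_continuousP => -[s a] [/= s01 Aa].
  pose F := within [set z : R^o * 'rV[R]_4 | unit_time z.1 /\ A z.2]
    (nbhs (s, a)).
  have FF : Filter F by exact: within_filter.
  suff cc : (1 - z.1) *: g z.2 + z.1 *: c @[z --> F] -->
      (1 - s) *: g a + s *: c.
    have ci := @pl_R3_in_S3_continuous R iota iotaP ((1 - s) *: g a + s *: c).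
    exact: (cvg_comp _ _ cc ci).
  have c1 : z.1 @[z --> F] --> s.
    have : {within [set z : R^o * 'rV[R]_4 | unit_time z.1 /\ A z.2],
        continuous fst} by apply: continuous_subspaceT; exact: fst_continuous.
    by move/subspace_continuousP => /(_ (s, a)); apply.
  have c2 : g z.2 @[z --> F] --> g a.
    have : {within [set z : R^o * 'rV[R]_4 | unit_time z.1 /\ A z.2],
        continuous (g \o snd)}.
      apply: within_continuous_map gc; first exact: snd_continuous.
      by move=> z [_ /Arng].
    by move/subspace_continuousP => /(_ (s, a)); apply.
  apply: cvgD; apply: cvgZ => //; last exact: cvg_cst.
  by apply: cvgB => //; exact: cvg_cst.
- move=> s _ /andP[s0 s1] /sA [y yc <-].
  exists ((1 - s) *: y + s *: c); last by rewrite /= gK.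
  rewrite /cube_at /=.
  have -> : (1 - s) *: y + s *: c - c = (1 - s) *: (y - c).
    by rewrite scalerBr scalerBl scale1r scalerBl scale1r opprB !addrA.
  rewrite normrZ ger0_norm ?subr_ge0 //; apply: le_trans yc.
  by rewrite ler_piMl // lerBlDr lerDl.
- move=> _ /sA [y _ <-] /=; by rewrite subr0 scale1r scale0r addr0 gK.
- by move=> a _ /=; rewrite subrr scale0r add0r scale1r.
Qed.

(** * Time slices of PL homotopies, and arcs in the circles *)

Lemma pl_homotopy_slice (R : realType) m (l : R -> 'I_m * 'rV[R]_2 -> 'rV[R]_4)
    (t : R) : pl_homotopy l -> unit_time t -> pl_map (l t).
Proof.
move=> [lpl lS] t01; split=> [i|p]; last exact: lS.
pose L (u : 'rV[R]_2) : R^o * 'rV[R]_2 := (0, u).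
have lin : linear L by move=> a u v; congr pair; rewrite /= ?scaler0 ?addr0.
pose LL := GRing.isLinear.Build R 'rV[R]_2 (R^o * 'rV[R]_2)%type _ L lin.
pose L' : {linear 'rV[R]_2 -> (R^o * 'rV[R]_2)%type} := HB.pack L LL.
have := pl_on_affine_comp L' ((t : R^o), 0) (lpl i).
have -> : [set x | annulus ((t : R^o, 0) + L' x)] = @sphere R 1.
  apply/seteqP; split => u; rewrite /annulus /= ?addr0 ?add0r; first by case.
  by move=> hu; split.
by congr (pl_on _ _); apply/funext => u /=; rewrite addr0 add0r.
Qed.

Lemma rV1_const (R : realType) (x : 'rV[R]_1) : x = const_mx (x 0 0).
Proof. by apply/rowP => j; rewrite mxE (ord1 j). Qed.

Lemma rV1_norm (R : realType) (x : 'rV[R]_1) : `|x| = `|x 0 0|.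
Proof.
apply/eqP; rewrite eq_le; apply/andP; split.
  by apply/rV_norm_leP => // j; rewrite (ord1 j).
exact/(rV_norm_leP _ (normr_ge0 x)).
Qed.

(** The arc over the interval of centre [c] and radius [|r|]. A negative [r] is allowed, so the arc
    from parameter 0 to [b] is the case [c = r = b / 2] for either sign of [b]. *)
Definition chart_arc (R : realType) m (i : 'I_m) (W : R -> 'rV[R]_2) (c r : R) :
    set ('I_m * 'rV[R]_2) :=
  [set (i, W (c + r * x 0 0)) | x in @cube R 'rV[R]_1].

Lemma chart_arcP (R : realType) m (i : 'I_m) (W : R -> 'rV[R]_2) (c r s : R) :
  `|s| <= 1 -> chart_arc i W c r (i, W (c + r * s)).
Proof.
move=> s1; exists (const_mx s); last by rewrite mxE.
by rewrite /cube /= rV1_norm mxE.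
Qed.

Lemma arc_chart_arc (R : realType) m (i : 'I_m) (W : R -> 'rV[R]_2) (c r : R) :
  injective W -> pl_on [set: 'rV[R]_1] (fun x => W (x 0 0)) -> r != 0 ->
  (forall s, `|s| <= 1 -> `|W (c + r * s)| = 1) ->
  arc_with_boundary (chart_arc i W c r)
    [set (i, W (c - r)); (i, W (c + r))].
Proof.
move=> injW plW r0 WS.
exists i, (fun x => W (c + r * x 0 0)); split => //.
- split.
    have := pl_on_setI (convex_polyhedron_ball 1 ler01)
      (pl_on_affine_comp (GRing.scale r : {linear 'rV[R]_1 -> 'rV[R]_1})
        (const_mx c) plW).
    by rewrite setTI; congr (pl_on _ _); apply/funext => x; rewrite !mxE.
  move=> x y _ _ /injW /addrI /(mulfI r0) xy.
  by rewrite (rV1_const x) xy -rV1_const.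
- move=> _ [x x1 <-]; by apply: WS; rewrite -rV1_norm.
- have Sp (s : R) : `|s| = 1 -> @sphere R 0 (const_mx s).
    by move=> s1; rewrite /sphere /= rV1_norm mxE.
  apply/seteqP; split => z /=.
    case=> ->; [exists (const_mx (-1)) | exists (const_mx 1)].
    + by apply: Sp; rewrite normrN normr1.
    + by rewrite mxE mulrN1.
    + by apply: Sp; rewrite normr1.
    + by rewrite mxE mulr1.
  move=> [x x1 <-].
  have /eqP : `|x 0 0| = 1 by rewrite -rV1_norm.
  rewrite eqr_norml ler01 andbT => /orP[]/eqP ->;
    rewrite ?mulrN ?mulr1; [by right|by left].
Qed.

(* The scales are built downwards, starting from r (k+1) = 1. *)
Lemma nested_scales (R : realType) (m n k : nat)
    (h : R -> 'I_m * 'rV[R]_2 -> 'rV[R]_n) : top_isotopy h ->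
  exists r s : nat -> R,
  [/\ forall j, 0 < r j /\ 0 < s j <= 1,
      forall j, (j <= k)%N -> r j <= r j.+1,
      forall j i t u v, (j <= k)%N -> unit_time t -> `|u| = 1 -> `|v| = 1 ->
        `|u - v| <= s j -> `|h t (i, u) - h t (i, v)| < r j.+1 / 2 &
      forall j i i' t u v, (j <= k)%N -> unit_time t -> `|u| = 1 -> `|v| = 1 ->
        `|h t (i, u) - h t (i', v)| < 2 * r j -> i = i' /\ `|u - v| < s j / 2].
Proof.
move=> hP.
(* One step downwards: from r_(j+1) obtain the pair of s_j and r_j. The pair [(0, 0)] for
   nonpositive [r] is a dummy that makes [step] total, as [choice] requires. *)
have step (r : R) : exists sr : R * R, 0 < r ->
    [/\ 0 < sr.1 <= 1, 0 < sr.2 <= r,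
      forall i t u v, unit_time t -> `|u| = 1 -> `|v| = 1 ->
        `|u - v| <= sr.1 -> `|h t (i, u) - h t (i, v)| < r / 2 &
      forall i i' t u v, unit_time t -> `|u| = 1 -> `|v| = 1 ->
        `|h t (i, u) - h t (i', v)| < 2 * sr.2 ->
        i = i' /\ `|u - v| < sr.1 / 2].
  case: (ltP 0 r) => r0; last by exists (0, 0).
  have [s s0 hs] := top_isotopy_equicontinuous hP (divr_gt0 r0 (ltr0n _ 2)).
  (* Halving [s] allows a non-strict bound on [|u - v|]; the cap 1 keeps the arcs within the range
     of [sphere1_chart]. *)
  pose s' := Num.min (s / 2) 1.
  have s'0 : 0 < s' by rewrite lt_min ltr01 divr_gt0.
  (* Separation is taken at half of [s'] because a chart parameter may be twice the distance. *)
  have [d d0 hd] := top_isotopy_separation hP (divr_gt0 s'0 (ltr0n _ 2)).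
  exists (s', Num.min (d / 2) r) => _; split => /=.
  - by rewrite s'0 /s' ge_min lexx orbT.
  - by rewrite lt_min r0 ge_min lexx orbT divr_gt0.
  - move=> i t u v ht hu hv uv; apply: hs => //; apply: le_lt_trans uv _.
    by rewrite /s' gt_min; apply/orP; left; lra.
  - move=> i i' t u v ht hu hv uv; apply: (hd _ _ t) => //.
    apply: lt_le_trans uv _; rewrite mulrC -ler_pdivlMr //.
    by rewrite ge_min lexx.
have [f hf] := choice step.
(* Truncated subtraction gives [r j = 1] for all [j > k], so positivity holds for every [j]. *)
pose r j := iter (k.+1 - j) (fun x => (f x).2) 1.
have r0 j : 0 < r j.
  rewrite /r; elim: (k.+1 - j)%N => [|a IH] /=; first exact: ltr01.
  by have [_ /andP[]] := hf _ IH.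
have rS j : (j <= k)%N -> r j = (f (r j.+1)).2.
  by move=> jk; rewrite /r subSn // subSS.
exists r, (fun j => (f (r j.+1)).1); split.
- by move=> j; split=> //; have [] := hf _ (r0 j.+1).
- by move=> j jk; rewrite rS //; have [_ /andP[]] := hf _ (r0 j.+1).
- by move=> j i t u v jk; have [_ _ + _] := hf _ (r0 j.+1); exact.
- move=> j i i' t u v jk; rewrite rS //.
  by have [_ _ _] := hf _ (r0 j.+1); exact.
Qed.

(** * Nested balls and arcs around a double point of the approximation *)

Unset Implicit Arguments.

Theorem theorem1p3 (R : realType)
    (iota : 'rV[R]_3 -> 'rV[R]_4) (iotaP : pl_R3_in_S3 iota)
    (k m : nat) (h : R -> 'I_m * 'rV[R]_2 -> 'rV[R]_3) (hP : top_isotopy h) :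
  exists eps : R, 0 < eps /\
    forall l : R -> 'I_m * 'rV[R]_2 -> 'rV[R]_3,
      generic_pl_homotopy (fun t p => iota (l t p)) ->
      (forall t p, 0 <= t <= 1 -> circles p -> `|l t p - h t p| < eps) ->
      strong_quasi_isotopy k (fun t p => iota (l t p)).
Proof.
have [r [s [rs0 rS hA hB]]] := nested_scales k hP.
have r0 j : 0 < r j by have [] := rs0 j.
have s0 j : 0 < s j by have [_ /andP[]] := rs0 j.
have s1 j : s j <= 1 by have [_ /andP[]] := rs0 j.
exists (r 0%N / 2); split; first by rewrite divr_gt0.
move=> l lgen lh; split=> // t tsing.
have [lpl _ /(_ t tsing)[x [p [q [dbl _]]]]] := lgen.
have t01 : unit_time t by case: tsing.
split; first exact: (pl_homotopy_slice lpl).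
exists x, p, q; split => //.
have [pq fib _] := dbl.
have iota_inj : injective iota.
  by have [_ _ [g gK _]] := iotaP; exact: can_inj gK.
have [cp lp] : circles p /\ iota (l t p) = x.
  by have : [set p; q] p by [left]; rewrite -fib => -[].
have [cq lq] : circles q /\ iota (l t q) = x.
  by have : [set p; q] q by [right]; rewrite -fib => -[].
have lpq : l t p = l t q by apply: iota_inj; rewrite lp lq.
case: p pq fib cp lp lpq {dbl} => i u pq fib cp lp lpq.
case: q pq fib cq lq lpq => i' v pq fib cq lq lpq.
have u1 : `|u| = 1 := cp. have v1 : `|v| = 1 := cq.
have rle j : (j <= k)%N -> r 0%N <= r j.
  elim: j => [//|j IH] jk; apply: le_trans (IH (ltnW jk)) _.
  exact: rS (ltnW jk).
have lh' z j : (j <= k.+1)%N -> circles z -> `|l t z - h t z| < r j / 2.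
  move=> jk cz; apply: lt_le_trans (lh t z t01 cz) _.
  rewrite ler_pM2r //; case: j jk => [//|j jk].
  by apply: le_trans (rle j jk) _; exact: rS.
(* Both [h]-images are within r_0 / 2 of the common value of [l t], hence within r_0 of each
   other. *)
have [ii' uv] : i = i' /\ `|u - v| < s 0%N / 2.
  apply: (hB 0%N _ _ t) => //.
  have := ler_distD (l t (i, u)) (h t (i, u)) (h t (i', v)).
  rewrite {2}lpq (distrC (h t _) (l t (i, u))).
  have := lh' _ 0%N isT cp; have := lh' _ 0%N isT cq; have := r0 0%N; lra.
subst i'.
have [W [W0 [injW plW] W1 WL Wsurj]] := sphere1_chart u1.
have vu : `|v - u| <= 1 / 2 by rewrite distrC; have := s1 0%N; lra.
have [b [vb bu]] := Wsurj v v1 vu.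
have bs : `|b| <= s 0%N by move: bu; rewrite distrC; lra.
have b0 : b / 2 != 0.
  apply: mulf_neq0; last by rewrite invr_eq0 pnatr_eq0.
  by apply/eqP => b0; apply: pq; rewrite vb b0 W0.
set c := h t (i, u).
(* J_0 is exactly the arc over the parameters from 0 to [b], that is, from [p] to [q]; the later
   arcs are centred at [p]. *)
pose P j := if j is 0%N then [set x] else iota @` cube_at c (r j).
pose J j := if j is 0%N then chart_arc i W (b / 2) (b / 2)
            else chart_arc i W 0 (s j).
exists P, J.
(* This covers J_0 too, as |b| is at most s_0. *)
have JW j z : J j z -> exists a, z = (i, W a) /\ `|a| <= s j.
  case: j => [|j] [y y1 <-]; rewrite /cube /= rV1_norm in y1.
    exists (b / 2 + b / 2 * y 0 0); split => //; apply: le_trans bs.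
    rewrite -{1}(mulr1 (b / 2)) -mulrDr normrM normrM.
    rewrite (ger0_norm (_ : 0 <= 2^-1)) //.
    rewrite -mulrA ler_piMr //.
    have := ler_normD 1 (y 0 0); rewrite normr1; lra.
  exists (0 + s j.+1 * y 0 0); split => //.
  by rewrite add0r normrM gtr0_norm // ger_pMr.
have W_arc (a : R) j : `|a| <= s j -> `|W a| = 1.
  by move=> aj; apply: W1; apply: le_trans aj (s1 j).
(* Half of r_(j+1) bounds the motion of [h] along the arc, the other half the distance from [l] to
   [h]. *)
have JP j : (j <= k)%N -> (fun z => iota (l t z)) @` J j `<=`
    iota @` cube_at c (r j.+1).
  move=> jk _ [z Jz <-]; exists (l t z) => //.
  have [a [-> aj]] := JW _ _ Jz; have Wa := W_arc _ _ aj.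
  have h1 : `|h t (i, W a) - c| < r j.+1 / 2.
    apply: (hA j) => //; apply: le_trans aj.
    by rewrite -{1}W0; apply: le_trans (WL _ _) _; rewrite subr0.
  have h2 := lh' (i, W a) j.+1 jk Wa.
  have := ler_distD (h t (i, W a)) (l t (i, W a)) c.
  rewrite /cube_at /=; lra.
split.
- by [].
- by move=> [//|j] _; exact: pl_3ball_cube_at.
- split.
    have := @arc_chart_arc R m i W (b / 2) (b / 2) injW plW b0.
    rewrite subrr W0 fib -splitr -vb; apply.
    move=> a a1; apply: (W_arc _ 0%N).
    have [] := JW 0%N (i, W (b / 2 + b / 2 * a)); first exact: chart_arcP.
    by move=> a' [[/injW ->]].
  move=> [|j] jk; eexists; apply: arc_chart_arc => //.
  + move=> a a1; apply: (W_arc _ 0%N).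
    have [] := JW 0%N (i, W (b / 2 + b / 2 * a)); first exact: chart_arcP.
    by move=> a' [[/injW ->]].
  + exact: lt0r_neq0.
  + move=> a a1; apply: (W_arc _ j.+1).
    by rewrite add0r normrM gtr0_norm // ger_pMr.
- move=> [|j] jk; rewrite /P.
    (* The two preimages are the ends of J_0, at the cube parameters -1 and 1. *)
    rewrite fib => z [] ->.
      have := @chart_arcP R m i W (b / 2) (b / 2) (-1).
      by rewrite mulrN1 subrr W0 normrN normr1; apply.
    have := @chart_arcP R m i W (b / 2) (b / 2) 1.
    by rewrite mulr1 -splitr -vb normr1; apply.
  move=> [i' w] [cw [y yc /iota_inj yw]].
  (* The cube contributes r_(j+1) and the approximation less than half of that, within the factor 2
     allowed by separation. *)
  have hw : `|h t (i, u) - h t (i', w)| < 2 * r j.+1.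
    have := ler_distD (l t (i', w)) (h t (i, u)) (h t (i', w)).
    have := lh' _ j.+1 (leqW jk) cw; rewrite -yw; move: yc.
    rewrite /cube_at /= -/c (distrC c y); have := r0 j.+1; lra.
  have [<- uw] := hB _ _ _ _ _ _ jk t01 u1 cw hw.
  rewrite distrC /= in uw.
  have wu : `|w - u| <= 1 / 2 by have := s1 j.+1; lra.
  (* Separation puts [w] within half of s_(j+1) of [u], so its parameter [a] is below s_(j+1) in
     absolute value. *)
  have [a [wW aw]] := Wsurj w cw wu.
  rewrite wW; have -> : a = 0 + s j.+1 * (a / s j.+1).
    by rewrite add0r mulrC divfK // lt0r_neq0.
  apply: chart_arcP; rewrite normrM normfV (gtr0_norm (s0 _)) ler_pdivrMr //.
  lra.
- move=> j jk; apply: null_homotopic_in_cube_at => // z [|];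
    last exact: (JP j (ltnW jk)).
  (* The double point lies in the first cube because [l] is r_1 / 2-close to [h] at [p]; later cubes
     are nested since the radii increase. *)
  case: j jk => [|j] jk; rewrite /P.
    move=> ->; exists (l t (i, u)) => //; rewrite /cube_at /=.
    by have := lh' _ 1%N isT cp; have := r0 1%N; rewrite -/c; lra.
  move=> [y yc <-]; exists y => //; apply: le_trans yc _; exact: rS (ltnW jk).
Qed.
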